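(* Let $X,Y$ be independent real-valued continuous random variables, let $(X_0,Y_0),(X_1,Y_1),\dots,(X_n,Y_n)$ be i.i.d. copies of $(X,Y)$, and set $S_i=X_i+Y_i$ for $i=0,\dots,n$. Then $$h(S_0+S_1+\cdots+S_n)\leq(2n+1)h(X+Y)-n\,h(X)-n\,h(Y).$$
   Context: Standing conventions: random variables are real-valued with densities and all differential entropies $h$ appearing exist and are finite. *)

(* Defs.v *)
From HB Require Import structures.
From mathcomp Require Import all_boot all_order all_algebra.
From mathcomp Require Import all_classical all_reals all_analysis.
Set Implicit Arguments. Unset Strict Implicit. Unset Printing Implicit Defensive.
Import Order.TTheory GRing.Theory Num.Theory.
Import numFieldNormedType.Exports.
Local Open Scope classical_set_scope.
Local Open Scope ring_scope.

Section Defs.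
Context {R : realType} {d : measure_display} {T : measurableType d}.

Definition mutually_independent (P : probability T R) (I : finType)
  (Z : I -> T -> R) : Prop :=
  forall B : I -> set R, (forall i, measurable (B i)) ->
    P (\bigcap_(i in [set: I]) (Z i @^-1` B i)) =
    (\prod_(i : I) P (Z i @^-1` B i))%E.

Definition same_distribution (P : probability T R) (Z1 Z2 : T -> R) : Prop :=
  forall B : set R, measurable B -> P (Z1 @^-1` B) = P (Z2 @^-1` B).

Definition has_density (P : probability T R) (Z : T -> R) (f : R -> R) : Prop :=
  [/\ measurable_fun [set: R] f, (forall x, 0 <= f x) &
      forall B : set R, measurable B ->
        P (Z @^-1` B) = (\int[lebesgue_measure]_(x in B) (f x)%:E)%E].

End Defs.

(* Differential entropy of a density f: h = - ∫ f ln f (with 0 ln 0 = 0). *)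
Definition entropy_finite {R : realType} (f : R -> R) : Prop :=
  (lebesgue_measure : measure _ R).-integrable [set: R] (fun x => (f x * ln (f x))%:E).

Definition diff_entropy {R : realType} (f : R -> R) : \bar R :=
  (- \int[lebesgue_measure]_x (f x * ln (f x))%:E)%E.

(* Main.v *)
Require Import Defs.
From HB Require Import structures.
From mathcomp Require Import all_boot all_order all_algebra.
From mathcomp Require Import all_classical all_reals all_analysis.
From mathcomp Require Import measurable_realfun.
From mathcomp Require Import ring lra.
Import Order.TTheory GRing.Theory Num.Theory.
Local Open Scope classical_set_scope.
Local Open Scope ring_scope.

(** Arrange the variables as X_0, Y_0, X_1, Y_1, ... =: Z_0, Z_1, Z_2, ... and let
    A_k be the partial sums.  Submodularity of entropy,
      h(A + Z + W) + h(Z) <= h(A + Z) + h(W + Z)   for independent A, Z, W,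
    applied to A_(k-1), Z_k, Z_(k+1) gives
      h(A_(k+1)) <= h(A_k) + h(X + Y) - h(Z_k),
    and 2n steps from A_1 = X_0 + Y_0 yield the theorem.

    With z, p, q, r the densities of Z, A + Z, W + Z, A + Z + W, submodularity
    follows from ln x <= x - 1 and
      E[p(A+Z) q(W+Z) / (r(A+Z+W) z(Z))]
        <= int E[p(s-W)] E[q(s-A)] / r(s) ds = int r(s) ds = 1.
    Together with E[r(A+Z+W) / p(A+Z)] <= 1 this squeezes ln r(A+Z+W) between
    integrable functions, so the entropies of the intermediate sums are finite. *)

Set Implicit Arguments.
Unset Strict Implicit.
Unset Printing Implicit Defensive.

(** * Translation invariance of Lebesgue measure *)

Section translation.
Context {R : realType}.
Notation mu := (@lebesgue_measure R).

(** The pushforward of [mu] under translation gives half-open intervals their length, and Lebesgue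
    measure is the only measure that does. *)
Lemma lebesgue_measure_translation (a : R) (A : set R) : measurable A ->
  mu ((fun x => x + a) @^-1` A) = mu A.
Proof.
move=> mA.
have mphi : measurable_fun setT (fun x : R => x + a).
  exact: measurable_funD.
pose phi := @mfun_Sub _ _ (measurableTypeR R) (measurableTypeR R) _ (mem_set mphi).
rewrite [RHS](@lebesgue_measure_unique _ (pushforward mu phi))// => X [[b c] _ <-].
rewrite /pushforward /=.
suff E : (fun x : R => x + a) @^-1` `]b, c] = `]b - a, c - a]%classic.
  rewrite [X in _ = mu X]E !lebesgue_measure_itv/= !lte_fin ltrD2r.
  by case: ifP => // _; rewrite -!EFinB; congr EFin; rewrite opprD opprK addrACA addNr addr0.
by apply/seteqP; split=> x /=; rewrite !in_itv/= ltrBlDr lerBrDr.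
Qed.

Lemma ge0_integral_translation (a : R) (f : R -> \bar R) :
  measurable_fun setT f -> (forall x, (0 <= f x)%E) ->
  (\int[mu]_x f (x + a)%R = \int[mu]_x f x)%E.
Proof.
move=> mf f0.
have mphi : measurable_fun setT (fun x : R => x + a).
  exact: measurable_funD.
rewrite -[LHS](@ge0_integral_pushforward _ _ (measurableTypeR R) (measurableTypeR R)
  _ _ mphi mu setT)//.
by apply: eq_measure_integral => A mA _; rewrite /= /pushforward lebesgue_measure_translation.
Qed.

End translation.

(** * Densities: uniqueness and the transfer formula for expectations *)

Section density.
Local Open Scope ereal_scope.
Context {R : realType} {d : measure_display} {T : measurableType d}.
Variable P : probability T R.
Notation mu := (@lebesgue_measure R).
Implicit Types (V : T -> R) (f g : R -> R).

Lemma integral_density V f : has_density P V f -> \int[mu]_x (f x)%:E = 1.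
Proof. by move=> [_ _ /(_ setT measurableT) <-]; rewrite preimage_setT probability_setT. Qed.

Lemma integrable_density V f : has_density P V f ->
  mu.-integrable setT (EFin \o f).
Proof.
move=> df; have [mf f0 _] := df; apply/integrableP; split.
  exact/measurable_EFinP.
under eq_integral do rewrite gee0_abs ?lee_fin//.
by rewrite (integral_density df) ltry.
Qed.

Lemma density_unique V f g : has_density P V f -> has_density P V g ->
  ae_eq mu setT (EFin \o f) (EFin \o g).
Proof.
move=> df [mg _ gE]; apply: integral_ae_eq => //.
- exact: integrable_density df.
- exact/measurable_EFinP.
- by move=> E _ mE; have [_ _ fE] := df; rewrite -fE// -gE.
Qed.

(** The law of [V] is absolutely continuous, and its Radon-Nikodym derivative has the same integrals
    over measurable sets as [f], hence equals [f] almost everywhere; change of variables for the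
    derivative does the rest. *)
Lemma ge0_expectation_density V f (g : R -> \bar R) : measurable_fun setT V ->
  has_density P V f -> measurable_fun setT g -> (forall x, 0 <= g x) ->
  \int[P]_t g (V t) = \int[mu]_x ((f x)%:E * g x).
Proof.
move=> mV df mg g0; have [mf f0 fE] := df.
pose nu := distribution P (@mfun_Sub _ _ T (measurableTypeR R) _ (mem_set mV)).
have numu : nu `<< mu.
  move=> A nA B mB BA; rewrite /nu /distribution /pushforward /= fE//.
  apply: null_set_integral => //; first exact/measurable_funTS/measurable_EFinP.
  exact: nA.
transitivity (\int[nu]_x g x).
  by rewrite ge0_integral_distribution.
rewrite -(Radon_Nikodym_SigmaFinite.change_of_variables numu)//.
apply: ge0_ae_eq_integral => //.
- apply: emeasurable_funM => //.
  exact: measurable_int (Radon_Nikodym_SigmaFinite.f_integrable numu).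
- by apply: emeasurable_funM => //; exact/measurable_EFinP.
- by move=> x _; rewrite mule_ge0// Radon_Nikodym_SigmaFinite.f_ge0.
- by move=> x _; rewrite mule_ge0// lee_fin.
have : ae_eq mu setT (Radon_Nikodym_SigmaFinite.f nu mu) (EFin \o f).
  apply: integral_ae_eq => //.
  + exact: Radon_Nikodym_SigmaFinite.f_integrable.
  + exact/measurable_EFinP.
  + by move=> E _ mE; rewrite -Radon_Nikodym_SigmaFinite.f_integral// -fE.
by apply: filterS => x + _ => /(_ I) /= ->; rewrite muleC.
Qed.

End density.

(** * Independence of two random elements and product laws *)

Section independence.
Local Open Scope ereal_scope.
Context {R : realType} {d d1 d2 : measure_display} {T : measurableType d}
  {T1 : measurableType d1} {T2 : measurableType d2}.
Variable P : probability T R.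

(** The codomains are arbitrary measurable spaces so that one side can be a pair of real
    variables. *)
Definition independent2 (V : T -> T1) (U : T -> T2) :=
  forall B C, measurable B -> measurable C ->
    P (V @^-1` B `&` U @^-1` C) = P (V @^-1` B) * P (U @^-1` C).

Variables (V : T -> T1) (U : T -> T2).
Hypotheses (mV : measurable_fun setT V) (mU : measurable_fun setT U).

Lemma measurable_preimageT d' (T' : measurableType d') (W : T -> T') (B : set T') :
  measurable_fun setT W -> measurable B -> measurable (W @^-1` B).
Proof. by move=> mW mB; rewrite -[X in measurable X]setTI; exact: mW. Qed.

(** Both sides are finite measures in [D] that agree on rectangles, an intersection-stable family
    generating the product sigma-algebra. This lifts product rules for several events to
    independence of a pair, and so of a sum. *)
Lemma independent_pair_event (E : set T) : measurable E ->
  (forall B C, measurable B -> measurable C ->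
    P (V @^-1` B `&` U @^-1` C `&` E) = P (V @^-1` B `&` U @^-1` C) * P E) ->
  forall D, measurable D ->
    P ((fun t => (V t, U t)) @^-1` D `&` E) =
    P ((fun t => (V t, U t)) @^-1` D) * P E.
Proof.
move=> mE indE D mD.
have mVU : measurable_fun setT (fun t => (V t, U t)) by exact: measurable_fun_pair.
pose VU : {mfun T >-> (T1 * T2)%type} := mfun_Sub (mem_set mVU).
have PE0 : (0 <= fine (P E))%R by exact: fine_ge0.
pose m1 : {measure set (T1 * T2) -> \bar R} :=
  pushforward (mrestr P mE) VU.
pose m2 : {measure set (T1 * T2) -> \bar R} :=
  mscale (NngNum PE0) (distribution P VU).
have m2E X : m2 X = P (VU @^-1` X) * P E.
  by rewrite /m2 /= /mscale /= fineK ?fin_num_measure// muleC.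
rewrite -[LHS]/(m1 mVU D) -[RHS]m2E.
pose G : set (set (T1 * T2)) :=
  [set C | exists A, measurable A /\ exists B, measurable B /\ C = A `*` B].
apply: (measure_unique G (fun=> setT)) => //.
- rewrite measurable_prod_measurableType//; congr (<<s _ >>).
  rewrite predeqE; split => [[A mA [B mB <-]]|[A [mA [B [mB ->]]]]].
    by exists A; split => //; exists B.
  by exists A => //; exists B.
- move=> /= _ _ [X1 [mX1 [X2 [mX2 ->]]]] [Y1 [mY1 [Y2 [mY2 ->]]]].
  rewrite -setXI; exists (X1 `&` Y1); split; first exact: measurableI.
  by exists (X2 `&` Y2); split => //; exact: measurableI.
- by move=> _; exists setT; split => //; exists setT; split => //; rewrite setXTT.
- by rewrite bigcup_const.
- by move=> _ [A [mA [B [mB ->]]]]; rewrite m2E; exact: indE.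
- move=> _; rewrite /m1 /= /pushforward/= /mrestr.
  rewrite (le_lt_trans (probability_le1 _ _)) ?ltry//.
  by rewrite preimage_setT setTI.
Qed.

Hypothesis VU : independent2 V U.

(** By uniqueness of the product measure, the joint law is the product of the marginal laws; Tonelli
    then iterates the integral. *)
Lemma ge0_expectation_independent (F : T1 * T2 -> \bar R) :
  measurable_fun setT F -> (forall x, 0 <= F x) ->
  \int[P]_t F (V t, U t) = \int[P]_t \int[P]_s F (V s, U t).
Proof.
move=> mF F0.
pose nV := distribution P (mfun_Sub (mem_set mV) : {RV P >-> T1}).
pose nU := distribution P (mfun_Sub (mem_set mU) : {RV P >-> T2}).
have mVU : measurable_fun setT (fun t => (V t, U t)) by exact: measurable_fun_pair.
pose nVU := distribution P (mfun_Sub (mem_set mVU) : {RV P >-> (T1 * T2)%type}).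
transitivity (\int[nVU]_x F x).
  by rewrite ge0_integral_distribution.
transitivity (\int[nV \x nU]_x F x).
  apply: eq_measure_integral => X mX _; apply/esym.
  by apply: product_measure_unique => // A B mA mB; exact: VU.
rewrite fubini_tonelli2// ge0_integral_distribution//=.
- apply: eq_integral => t _; rewrite /fubini_G ge0_integral_distribution//.
  exact: measurableT_comp.
- exact: measurable_fun_fubini_tonelli_G.
- by move=> y; exact: integral_ge0.
Qed.

End independence.

Section independent_density.
Local Open Scope ereal_scope.
Context {R : realType} {d d2 : measure_display} {T : measurableType d}
  {T2 : measurableType d2}.
Variable P : probability T R.
Notation mu := (@lebesgue_measure R).

Lemma ge0_expectation_independent_density (V : T -> R) (U : T -> T2) (f : R -> R)
    (F : R * T2 -> \bar R) :
  measurable_fun setT V -> measurable_fun setT U -> independent2 P V U ->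
  has_density P V f -> measurable_fun setT F -> (forall x, 0 <= F x) ->
  \int[P]_t F (V t, U t) = \int[P]_t \int[mu]_x ((f x)%:E * F (x, U t)).
Proof.
move=> mV mU VU df mF F0; rewrite ge0_expectation_independent//.
apply: eq_integral => t _.
rewrite -(ge0_expectation_density mV df (g := fun x => F (x, U t)))//.
exact: measurableT_comp.
Qed.

End independent_density.

(** * Densities of independent sums *)

Lemma ge0_measurable_funV {R : realType} {d : measure_display}
    {T : measurableType d} (f : T -> R) :
  measurable_fun setT f -> (forall x, 0 <= f x) ->
  measurable_fun setT (fun x => (f x)^-1).
Proof.
move=> mf f0; under eq_fun do rewrite -powR_inv1//.
exact: measurableT_comp (measurable_powR _) mf.
Qed.

Section convolution.
Local Open Scope ereal_scope.
Context {R : realType} {d : measure_display} {T : measurableType d}.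
Variable P : probability T R.
Notation mu := (@lebesgue_measure R).

(** For each fixed [t] the substitution [x = s - c t] preserves [mu]; Tonelli then exchanges the
    integrals. It trades an integration over one summand for an integration over the value [s] of
    the whole sum. *)
Lemma ge0_fubini_tonelli_translation (H : R * T -> \bar R) (c : T -> R) :
  measurable_fun setT H -> (forall x, 0 <= H x) -> measurable_fun setT c ->
  \int[P]_t \int[mu]_x H (x, t) = \int[mu]_s \int[P]_t H ((s - c t)%R, t).
Proof.
move=> mH H0 mc.
pose K (y : measurableTypeR R * T) := H ((y.1 - c y.2)%R, y.2).
have mK : measurable_fun setT K.
  apply: (measurableT_comp mH); apply: measurable_fun_pair => //.
  apply: (@measurable_funB _ (measurableTypeR R * T)%type R) => //.
  exact: measurableT_comp.
rewrite (fubini_tonelli (m1 := mu) (m2 := P) K)//; last by move=> ?; exact: H0.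
apply: eq_integral => t _.
rewrite -(ge0_integral_translation (- c t) (f := fun x => H (x, t)))//.
exact: measurableT_comp.
Qed.

Variables (V W : T -> R) (p : R -> R).
Hypotheses (mV : measurable_fun setT V) (mW : measurable_fun setT W).
Hypotheses (VW : independent2 P V W) (Vp : has_density P V p).

(** Convolution of [p] with the law of [W], written as an expectation because no density of [W] is
    given here. It is extended-real since it may be infinite on a null set. *)
Let conv s := \int[P]_t (p (s - W t))%:E.

Let mp : measurable_fun setT p. Proof. by case: Vp. Qed.
Let p0 x : (0 <= p x)%R. Proof. by case: Vp. Qed.

Let conv_ge0 s : 0 <= conv s.
Proof. by apply: integral_ge0 => t _; rewrite lee_fin. Qed.

Let measurable_conv : measurable_fun setT conv.
Proof.
apply: (measurable_fun_fubini_tonelli_F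
  (fun y : measurableTypeR R * T => (p (y.1 - W y.2))%:E)).
  apply/measurable_EFinP/(measurableT_comp mp).
  apply: (@measurable_funB _ (measurableTypeR R * T)%type R) => //.
  exact: measurableT_comp.
by move=> x; rewrite lee_fin.
Qed.

Let prob_conv B : measurable B ->
  P ((fun t => V t + W t)%R @^-1` B) = \int[mu]_(s in B) conv s.
Proof.
move=> mB.
have mVW : measurable_fun setT (fun t => V t + W t)%R by exact: measurable_funD.
rewrite -[X in P X]setIT -integral_indic//; last exact: measurable_preimageT.
rewrite (_ : \int[P]_t _ =
    \int[P]_t (\1_B ((V t, W t).1 + (V t, W t).2)%R)%:E)//.
rewrite (ge0_expectation_independent_density mV mW VW Vp
  (F := fun y => (\1_B (y.1 + y.2)%R)%:E)); last 2 first.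
- apply/measurable_EFinP.
  apply: (measurableT_comp (measurable_indic mB)).
  exact: measurable_funD.
- by move=> x; rewrite lee_fin.
rewrite (@ge0_fubini_tonelli_translation
    (fun y => ((p y.1)%:E * (\1_B (y.1 + W y.2)%R)%:E)) W)//; last 2 first.
- apply: emeasurable_funM; apply/measurable_EFinP; first exact: measurableT_comp.
  apply: (measurableT_comp (measurable_indic mB)).
  apply: measurable_funD => //; exact: measurableT_comp.
- by move=> x; rewrite mule_ge0// lee_fin.
rewrite [RHS]integral_mkcond; apply: eq_integral => s _ /=.
rewrite patchE; under eq_integral do rewrite subrK indicE.
case: ifPn => sB.
  by under eq_integral do rewrite mule1.
by under eq_integral do rewrite mule0; rewrite integral0.
Qed.

Let integral_conv : \int[mu]_s conv s = 1.
Proof.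
by rewrite -(prob_conv measurableT) preimage_setT probability_setT.
Qed.

Lemma has_density_add : exists r, has_density P (fun t => V t + W t)%R r.
Proof.
have iconv : mu.-integrable setT conv.
  apply/integrableP; split => //.
  by under eq_integral do rewrite gee0_abs//; rewrite integral_conv ltry.
(* A density must be real-valued; [conv] has integral 1, hence is finite almost everywhere, and
   [fine] alters it only on a null set. *)
exists (fine \o conv); split => [||B mB].
- exact: measurableT_comp.
- by move=> x /=; rewrite fine_ge0.
- rewrite prob_conv//; apply: ge0_ae_eq_integral => //.
  + exact: measurable_funTS.
  + by apply/measurable_EFinP/measurable_funTS; exact: measurableT_comp.
  + by move=> x _ /=; rewrite lee_fin fine_ge0.
  + have := integrable_ae measurableT iconv.
    by apply: filterS => x /(_ I) fx _ /=; rewrite fineK.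
Qed.

(** The convolution and [r] have the same integral over every measurable set, which identifies them
    up to a null set. *)
Lemma density_addE r : has_density P (fun t => V t + W t)%R r ->
  {ae mu, forall s, \int[P]_t (p (s - W t))%:E = (r s)%:E}.
Proof.
move=> dr; have := @integral_ae_eq _ _ _ mu setT measurableT conv (EFin \o r).
move=> /(_ (integrable_density dr) measurable_conv) [E _ mE|].
  by have [_ _ <-//] := dr; exact: prob_conv.
by move=> N [? ? sub]; exists N; split => //; apply: subset_trans sub => x /= + /(_ I) /esym.
Qed.

(** Given [W], integrating against the density [p] of [V] cancels the denominator and leaves at most
    a translate of [r], of integral 1. Only an inequality results, because where [p] vanishes the
    integrand is 0 while [r] may be positive. *)
Lemma ge0_expectation_density_ratio_add r :
  has_density P (fun t => V t + W t)%R r ->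
  \int[P]_t (r (V t + W t) / p (V t))%:E <= 1.
Proof.
move=> dr; have [mr r0 _] := dr.
have minv : measurable_fun setT (fun y : R * R => (p y.1)^-1%R).
  by apply: ge0_measurable_funV => //; exact: measurableT_comp.
have mrD : measurable_fun setT (fun y : R * R => r (y.1 + y.2)%R).
  by apply: measurableT_comp => //; exact: measurable_funD.
rewrite (ge0_expectation_independent_density mV mW VW Vp
  (F := fun y => (r (y.1 + y.2) / p y.1)%:E))/=; last 2 first.
- by apply/measurable_EFinP; exact: measurable_funM.
- by move=> y; rewrite lee_fin divr_ge0.
apply: (@le_trans _ _ (\int[P]_t (cst 1%E t))); last first.
  by rewrite integral_cst// mul1e; exact: probability_le1.
have mF : measurable_fun setT (fun y : measurableTypeR R * T =>
    (p y.1)%:E * (r (y.1 + W y.2) / p y.1)%:E).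
  apply: emeasurable_funM; apply/measurable_EFinP; first exact: measurableT_comp.
  apply: measurable_funM.
    apply: measurableT_comp => //.
    by apply: (@measurable_funD _ (measurableTypeR R * T)%type R) => //; exact: measurableT_comp.
  by apply: ge0_measurable_funV => //; exact: measurableT_comp.
apply: ge0_le_integral => //.
- by move=> t _; apply: integral_ge0 => x _; rewrite -EFinM lee_fin mulr_ge0// divr_ge0.
- apply: (measurable_fun_fubini_tonelli_G (m1 := mu) _ mF).
  by move=> y; rewrite -EFinM lee_fin mulr_ge0// divr_ge0.
move=> t _ /=.
rewrite -(integral_density dr) -(ge0_integral_translation (W t)); last 2 first.
- exact/measurable_EFinP.
- by move=> x; rewrite lee_fin.
apply: ge0_le_integral => //.
- by move=> x _; rewrite -EFinM lee_fin mulr_ge0// divr_ge0.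
- exact: (@measurable_fun_pair1 _ _ _ (measurableTypeR R) T _ _ t mF).
- by apply/measurable_EFinP/measurableT_comp => //; exact: measurable_funD.
- move=> x _; rewrite -EFinM lee_fin mulrC; have [->|p1] := eqVneq (p x) 0%R.
    by rewrite mulr0.
  by rewrite divfK.
Qed.

End convolution.

(** * Integral comparison under almost-everywhere bounds *)

Section ae_comparison.
Context {R : realType} {d : measure_display} {T : measurableType d}.
Variable mu : {measure set T -> \bar R}.
Implicit Types f g : T -> R.

Lemma ae_le_Rintegral f g :
  mu.-integrable setT (EFin \o f) -> mu.-integrable setT (EFin \o g) ->
  {ae mu, forall x, f x <= g x} ->
  \int[mu]_x f x <= \int[mu]_x g x.
Proof.
move=> intf intg fg; rewrite -subr_ge0 -RintegralB//.
have intgf : mu.-integrable setT (EFin \o (fun x => g x - f x)).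
  exact: (integrableB measurableT intg intf).
have mgf := measurable_int _ intgf.
(* The difference may be negative on a null set, so it is replaced by its absolute value, which is
   nonnegative everywhere. *)
rewrite /Rintegral (@ae_eq_integral _ _ _ _ _
  (fun x => `|(g x - f x)%:E|)%E)//.
- by apply: fine_ge0; exact: integral_ge0.
- exact: measurableT_comp mgf.
- by apply: filterS fg => x fgx _ /=; rewrite ger0_norm// subr_ge0.
Qed.

Lemma ae_integrable_squeeze f g h : measurable_fun setT f ->
  mu.-integrable setT (EFin \o g) -> mu.-integrable setT (EFin \o h) ->
  {ae mu, forall x, g x <= f x <= h x} ->
  mu.-integrable setT (EFin \o f).
Proof.
move=> mf intg inth gfh; have mf' : measurable_fun setT (EFin \o f).
  exact/measurable_EFinP.
apply/integrableP; split => //.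
(* The dominating function is [|g| + |h|]. *)
have /integrableP[m1 fin1] :=
  integrableD measurableT (integrable_abse intg) (integrable_abse inth).
apply: le_lt_trans fin1; apply: ae_ge0_le_integral => //.
- exact: measurableT_comp mf'.
- exact: measurableT_comp m1.
- apply: filterS gfh => x /andP[gf fh] _ /=.
  rewrite lee_fin [leRHS]ger0_norm ?addr_ge0// ler_norml.
  have := ler_norm (g x); have := ler_norm (- g x); have := ler_norm (h x).
  have := ler_norm (- h x); rewrite !normrN; lra.
Qed.

End ae_comparison.

Lemma ln_le_subr1 {R : realType} (x : R) : 0 < x -> ln x <= x - 1.
Proof. by move=> x0; rewrite -{1}(subrKC 1 x) le_ln1Dx//; lra. Qed.

(** * Entropy as an expectation *)

Section entropy_expectation.
Local Open Scope ereal_scope.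
Context {R : realType} {d : measure_display} {T : measurableType d}.
Variable P : probability T R.
Notation mu := (@lebesgue_measure R).
Variables (V : T -> R) (f : R -> R).
Hypotheses (mV : measurable_fun setT V) (Vf : has_density P V f).

Let mf : measurable_fun setT f. Proof. by case: Vf. Qed.
Let f0 x : (0 <= f x)%R. Proof. by case: Vf. Qed.

Let mln : measurable_fun setT (fun x => ln (f x)).
Proof. by apply: measurableT_comp => //; exact: measurable_ln. Qed.

Lemma measurable_ln_density : measurable_fun setT (fun t => ln (f (V t))).
Proof. exact: measurableT_comp mln mV. Qed.

(** Moving to the underlying probability space lets pointwise inequalities between logarithms of
    densities of different variables be integrated together. *)
Lemma entropy_finiteE :
  entropy_finite f <-> P.-integrable setT (fun t => (ln (f (V t)))%:E).
Proof.
rewrite /entropy_finite.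
have E : \int[P]_t `|(ln (f (V t)))%:E| = \int[mu]_x `|(f x * ln (f x))%:E|.
  rewrite (ge0_expectation_density mV Vf (g := fun x => `|(ln (f x))%:E|))//.
    by apply: eq_integral => x _; rewrite EFinM abseM (gee0_abs (x := (f x)%:E))// lee_fin.
  by apply: measurableT_comp => //; exact/measurable_EFinP.
split=> /integrableP[_ lty]; apply/integrableP; split.
- exact/measurable_EFinP/measurable_ln_density.
- by rewrite E.
- by apply/measurable_EFinP; exact: measurable_funM.
- by rewrite -E.
Qed.

(** The transfer formula concerns nonnegative functions, so positive and negative parts are treated
    separately; the factor [f x] leaves the maximum because it is nonnegative. *)
Lemma diff_entropyE : diff_entropy f = - \int[P]_t (ln (f (V t)))%:E.
Proof.
rewrite /diff_entropy; congr oppe; rewrite integralE [RHS]integralE; congr (_ - _).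
- rewrite [RHS](_ : _ = \int[P]_t (fun x => (ln (f x))%:E)^\+ (V t)); last first.
    by apply: eq_integral => t _; rewrite !funeposE.
  rewrite (ge0_expectation_density mV Vf)//.
    apply: eq_integral => x _; rewrite !funeposE EFinM maxeMr ?mule0//.
    by rewrite lee_fin.
  by apply: measurable_funepos; exact/measurable_EFinP.
- rewrite [RHS](_ : _ = \int[P]_t (fun x => (ln (f x))%:E)^\- (V t)); last first.
    by apply: eq_integral => t _; rewrite !funenegE.
  rewrite (ge0_expectation_density mV Vf)//.
    apply: eq_integral => x _; rewrite !funenegE EFinM -muleN maxeMr ?mule0//.
    by rewrite lee_fin.
  by apply: measurable_funeneg; exact/measurable_EFinP.
Qed.

(** The zero set of [f] has probability the integral of [f] over it, which is 0. This justifies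
    taking logarithms of quotients of densities almost surely. *)
Lemma density_gt0_ae : {ae P, forall t, (0 < f (V t))%R}.
Proof.
have mN : measurable (f @^-1` [set 0%R]) by exact: measurable_preimageT.
exists (V @^-1` (f @^-1` [set 0%R])); split.
- exact: measurable_preimageT.
- have [_ _ ->//] := Vf; apply: integral0_eq => x /= -> //.
- by move=> t /= ft; apply/eqP; rewrite eq_le f0 andbT leNgt; exact/negP.
Qed.

End entropy_expectation.

(** * Submodularity of entropy for independent sums *)

Section submodularity.
Local Open Scope ereal_scope.
Context {R : realType} {d : measure_display} {T : measurableType d}.
Variable P : probability T R.
Notation mu := (@lebesgue_measure R).
Variables (A W Z : T -> R) (z p q r : R -> R).
Hypotheses (mA : measurable_fun setT A) (mW : measurable_fun setT W)
  (mZ : measurable_fun setT Z).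
Hypotheses (Z_AW : independent2 P Z (fun t => (A t, W t)))
  (AW : independent2 P A W)
  (AZ_W : independent2 P (fun t => A t + Z t)%R W)
  (WZ_A : independent2 P (fun t => W t + Z t)%R A).
Hypotheses (dz : has_density P Z z) (dp : has_density P (fun t => A t + Z t)%R p)
  (dq : has_density P (fun t => W t + Z t)%R q)
  (dr : has_density P (fun t => A t + Z t + W t)%R r).

Let mz : measurable_fun setT z. Proof. by case: dz. Qed.
Let mp : measurable_fun setT p. Proof. by case: dp. Qed.
Let mq : measurable_fun setT q. Proof. by case: dq. Qed.
Let mr : measurable_fun setT r. Proof. by case: dr. Qed.
Let z0 x : (0 <= z x)%R. Proof. by case: dz. Qed.
Let p0 x : (0 <= p x)%R. Proof. by case: dp. Qed.
Let q0 x : (0 <= q x)%R. Proof. by case: dq. Qed.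
Let r0 x : (0 <= r x)%R. Proof. by case: dr. Qed.

Let mAZ : measurable_fun setT (fun t => A t + Z t)%R.
Proof. exact: measurable_funD. Qed.
Let mWZ : measurable_fun setT (fun t => W t + Z t)%R.
Proof. exact: measurable_funD. Qed.

Let expectation_factor s :
  \int[P]_t (p (s - W t) * q (s - A t))%:E =
  (\int[P]_t (p (s - W t))%:E) * (\int[P]_t (q (s - A t))%:E).
Proof.
have mpW : measurable_fun setT (fun t => p (s - W t)).
  by apply: measurableT_comp => //; exact: measurable_funB.
have mqA : measurable_fun setT (fun t => q (s - A t)).
  by apply: measurableT_comp => //; exact: measurable_funB.
rewrite (ge0_expectation_independent mA mW AW
  (F := fun y => (p (s - y.2) * q (s - y.1))%:E))/=; last 2 first.
- apply/measurable_EFinP; apply: measurable_funM; apply: measurableT_comp => //.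
    exact: measurable_funB.
  exact: measurable_funB.
- by move=> y; rewrite lee_fin mulr_ge0.
under eq_integral => t _.
  under eq_integral do rewrite EFinM.
  rewrite ge0_integralZl//; last 3 first.
    exact/measurable_EFinP.
    by move=> u _; rewrite lee_fin.
    by rewrite lee_fin.
  over.
rewrite ge0_integralZr//.
- exact/measurable_EFinP.
- by move=> u _; rewrite lee_fin.
- by apply: integral_ge0 => u _; rewrite lee_fin.
Qed.

(** Exponential form of submodularity: for finite entropies, the logarithm of this ratio has
    expectation h(r) + h(z) - h(p) - h(q), and [ln x <= x - 1] turns a mean of at most 1 into a
    bound by 0. *)
Lemma ge0_expectation_density_ratio_submodular :
  \int[P]_t (p (A t + Z t) * q (W t + Z t) / (r (A t + Z t + W t) * z (Z t)))%:E
  <= 1.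
Proof.
have mAW : measurable_fun setT (fun t => (A t, W t)) by exact: measurable_fun_pair.
rewrite (ge0_expectation_independent_density mZ mAW Z_AW dz
  (F := fun y : R * (R * R) => (p (y.2.1 + y.1) * q (y.2.2 + y.1) /
    (r (y.2.1 + y.1 + y.2.2) * z y.1))%:E))/=; last 2 first.
- apply/measurable_EFinP; apply: measurable_funM; last apply: ge0_measurable_funV.
  + apply: measurable_funM; apply: measurableT_comp => //; apply: measurable_funD => //;
    exact: measurableT_comp.
  + apply: measurable_funM; apply: measurableT_comp => //.
    apply: measurable_funD; first apply: measurable_funD => //; exact: measurableT_comp.
  + by move=> y; rewrite mulr_ge0.
- by move=> y; rewrite lee_fin divr_ge0// mulr_ge0.
(* [H] is the integrand after [Z] is integrated against [z]; [K] is [H] with [z] cancelled. They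
   agree where [z] is nonzero, and elsewhere [H] is 0, so [H <= K]. *)
pose K (y : measurableTypeR R * T) := (p (A y.2 + y.1) * q (W y.2 + y.1) /
  r (A y.2 + y.1 + W y.2))%:E.
pose H (y : measurableTypeR R * T) := (z y.1)%:E * (p (A y.2 + y.1) *
  q (W y.2 + y.1) / (r (A y.2 + y.1 + W y.2) * z y.1))%:E.
have mfst : measurable_fun setT (fun y : measurableTypeR R * T => y.1 : R).
  exact: (@measurable_fst _ _ (measurableTypeR R) T).
have mAx : measurable_fun setT (fun y : measurableTypeR R * T => A y.2 + y.1)%R.
  by apply: measurable_funD => //; exact: measurableT_comp.
have mWx : measurable_fun setT (fun y : measurableTypeR R * T => W y.2 + y.1)%R.
  by apply: measurable_funD => //; exact: measurableT_comp.
have mAWx : measurable_fun setT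
    (fun y : measurableTypeR R * T => A y.2 + y.1 + W y.2)%R.
  by apply: measurable_funD => //; exact: measurableT_comp.
have mpq : measurable_fun setT
    (fun y : measurableTypeR R * T => p (A y.2 + y.1) * q (W y.2 + y.1))%R.
  by apply: measurable_funM; exact: measurableT_comp.
have mrx : measurable_fun setT
    (fun y : measurableTypeR R * T => r (A y.2 + y.1 + W y.2))%R.
  exact: measurableT_comp.
have mK : measurable_fun setT K.
  by apply/measurable_EFinP/measurable_funM => //; exact: ge0_measurable_funV.
have K0 y : 0 <= K y by rewrite lee_fin divr_ge0// mulr_ge0.
have mH : measurable_fun setT H.
  apply: emeasurable_funM; apply/measurable_EFinP; first exact: measurableT_comp.
  apply: measurable_funM => //; apply: ge0_measurable_funV.
    by apply: measurable_funM => //; exact: measurableT_comp.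
  by move=> y; rewrite mulr_ge0.
have H0 y : 0 <= H y by rewrite /H -EFinM lee_fin mulr_ge0// divr_ge0// mulr_ge0.
apply: (@le_trans _ _ (\int[P]_t \int[mu]_x K (x, t))).
  rewrite -[leLHS]/(\int[P]_t \int[mu]_x H (x, t)).
  apply: ge0_le_integral => //.
  - by move=> t _; exact: integral_ge0.
  - exact: (measurable_fun_fubini_tonelli_G (m1 := mu) H).
  - exact: (measurable_fun_fubini_tonelli_G (m1 := mu) K).
  move=> t _; apply: ge0_le_integral => //.
  - exact: (measurable_fun_pair1 t mH).
  - exact: (measurable_fun_pair1 t mK).
  move=> x _; rewrite /H /K -EFinM lee_fin/=.
  have [->|zx] := eqVneq (z x) 0%R; first by rewrite mul0r divr_ge0// mulr_ge0.
  by rewrite invfM mulrCA (mulrC (z x)) mulrVK ?unitfE.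
(* With [x = s - (A + W)] the arguments of [p], [q], [r] become [s - W], [s - A] and [s], so the
   denominator is no longer random. *)
rewrite (@ge0_fubini_tonelli_translation _ _ _ P K (fun t => A t + W t)%R)//; last first.
  exact: measurable_funD.
rewrite -(integral_density dr).
apply: ae_ge0_le_integral => //.
- by move=> s _; exact: integral_ge0.
- apply: (measurable_fun_fubini_tonelli_F (m2 := P)
    (fun y : measurableTypeR R * T => K ((y.1 - (A y.2 + W y.2))%R, y.2))) => //.
  apply: (measurableT_comp mK); apply: measurable_fun_pair => //.
  apply: (@measurable_funB _ (measurableTypeR R * T)%type R) => //.
  by apply: measurable_funD; exact: measurableT_comp.
- by move=> s _; rewrite lee_fin.
- exact/measurable_EFinP.
(* The total is both (A + Z) + W and (W + Z) + A, so the convolution of [p] with the law of [W] and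
   that of [q] with the law of [A] both equal [r] almost everywhere. *)
have Ep := density_addE mAZ mW AZ_W dp dr.
have dr' : has_density P (fun t => W t + Z t + A t)%R r.
  by under eq_fun do rewrite addrC addrCA addrC.
have Eq := density_addE mWZ mA WZ_A dq dr'.
apply: (filterS2 (ae_filter_ringOfSetsType mu) _ Ep Eq) => s Eps Eqs _.
under eq_integral => t _.
  rewrite /K/= (_ : A t + (s - (A t + W t)) = s - W t)%R; last first.
    by ring.
  rewrite (_ : W t + (s - (A t + W t)) = s - A t)%R; last first.
    by ring.
  rewrite subrK mulrC EFinM.
  over.
rewrite ge0_integralZl//; last 3 first.
- apply/measurable_EFinP/measurable_funM; apply: measurableT_comp => //;
  exact: measurable_funB.
- by move=> t _; rewrite lee_fin mulr_ge0.
- by rewrite lee_fin invr_ge0.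
(* What remains is r(s) r(s) / r(s), which is r(s) even at zeros of [r], where the inverse is 0. *)
rewrite expectation_factor Eps Eqs -!EFinM lee_fin.
have [->|rs] := eqVneq (r s) 0%R; first by rewrite !mulr0.
by rewrite mulKf.
Qed.

Let mAZW : measurable_fun setT (fun t => A t + Z t + W t)%R.
Proof. exact: measurable_funD. Qed.

Lemma entropy_submodular :
  entropy_finite z -> entropy_finite p -> entropy_finite q ->
  entropy_finite r /\
  diff_entropy r + diff_entropy z <= diff_entropy p + diff_entropy q.
Proof.
move=> /(entropy_finiteE mZ dz) iz /(entropy_finiteE mAZ dp) ip.
move=> /(entropy_finiteE mWZ dq) iq.
pose Lz t := ln (z (Z t)); pose Lp t := ln (p (A t + Z t)%R).
pose Lq t := ln (q (W t + Z t)%R); pose Lr t := ln (r (A t + Z t + W t)%R).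
pose R1 t := (r (A t + Z t + W t) / p (A t + Z t))%R.
pose R2 t := (p (A t + Z t) * q (W t + Z t) / (r (A t + Z t + W t) * z (Z t)))%R.
have mzZ : measurable_fun setT (fun t => z (Z t)) by exact: measurableT_comp.
have mpAZ : measurable_fun setT (fun t => p (A t + Z t)%R) by exact: measurableT_comp.
have mqWZ : measurable_fun setT (fun t => q (W t + Z t)%R) by exact: measurableT_comp.
have mrS : measurable_fun setT (fun t => r (A t + Z t + W t)%R).
  exact: measurableT_comp.
have R10 t : (0 <= R1 t)%R by rewrite divr_ge0.
have R20 t : (0 <= R2 t)%R by rewrite divr_ge0// mulr_ge0.
have R1le : \int[P]_t (R1 t)%:E <= 1.
  exact: (ge0_expectation_density_ratio_add mAZ mW AZ_W dp dr).
have R2le := ge0_expectation_density_ratio_submodular.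
have iR1 : P.-integrable setT (EFin \o R1).
  apply/integrableP; split.
    by apply/measurable_EFinP/measurable_funM => //; exact: ge0_measurable_funV.
  under eq_integral do rewrite gee0_abs ?lee_fin//.
  by rewrite (le_lt_trans R1le)// ltry.
have iR2 : P.-integrable setT (EFin \o R2).
  apply/integrableP; split.
    apply/measurable_EFinP/measurable_funM; first exact: measurable_funM.
    by apply: ge0_measurable_funV => [|t]; [exact: measurable_funM|rewrite mulr_ge0].
  under eq_integral do rewrite gee0_abs ?lee_fin//.
  by rewrite (le_lt_trans R2le)// ltry.
have i1 : P.-integrable setT (EFin \o (fun=> 1%R : R)).
  exact: finite_measure_integrable_cst.
(* These bounds are [ln R2 <= R2 - 1] and [ln R1 <= R1 - 1] solved for [Lr]. *)
pose lo t := (Lp t + Lq t - Lz t - R2 t + 1)%R.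
pose up t := (Lp t + R1 t - 1)%R.
have ipq : P.-integrable setT (EFin \o (fun t => Lp t + Lq t)%R).
  exact: (integrableD measurableT ip iq).
have ipqz : P.-integrable setT (EFin \o (fun t => Lp t + Lq t - Lz t)%R).
  exact: (integrableB measurableT ipq iz).
have ipqzR : P.-integrable setT (EFin \o (fun t => Lp t + Lq t - Lz t - R2 t)%R).
  exact: (integrableB measurableT ipqz iR2).
have ilo : P.-integrable setT (EFin \o lo).
  exact: (integrableD measurableT ipqzR i1).
have ipR : P.-integrable setT (EFin \o (fun t => Lp t + R1 t)%R).
  exact: (integrableD measurableT ip iR1).
have iup : P.-integrable setT (EFin \o up).
  exact: (integrableB measurableT ipR i1).
have bounds : {ae P, forall t, (lo t <= Lr t <= up t)%R}.
  have gz := density_gt0_ae mZ dz; have gp := density_gt0_ae mAZ dp.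
  have gq := density_gt0_ae mWZ dq; have gr := density_gt0_ae mAZW dr.
  have gzp : {ae P, forall t, (0 < z (Z t))%R /\ (0 < p (A t + Z t))%R}.
    exact: filterI gz gp.
  apply: filterS3 gzp gq gr => t [zt pt] qt rt.
  have := @ln_le_subr1 _ (R1 t); have := @ln_le_subr1 _ (R2 t).
  rewrite /R1 /R2 !ln_div ?lnM ?posrE ?divr_gt0 ?mulr_gt0//.
  rewrite -/(R1 t) -/(R2 t) -/(Lp t) -/(Lq t) -/(Lz t) -/(Lr t).
  by move=> /(_ isT) h2 /(_ isT) h1; rewrite /lo /up; lra.
have iLr : P.-integrable setT (EFin \o Lr).
  by apply: (ae_integrable_squeeze _ ilo iup bounds); exact: (measurable_ln_density mAZW dr).
split; first exact/(entropy_finiteE mAZW dr).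
rewrite (diff_entropyE mAZW dr) (diff_entropyE mZ dz) (diff_entropyE mAZ dp)
  (diff_entropyE mWZ dq).
have finE L : P.-integrable setT (EFin \o L) ->
    \int[P]_t (L t)%:E = (\int[P]_t L t)%R%:E.
  by move=> iL; rewrite fineK//; exact: integrable_fin_num.
rewrite (finE Lr)// (finE Lz)// (finE Lp)// (finE Lq)//.
(* Integrating the lower bound, with the mean of [R2] at most 1, gives the entropy inequality. *)
have : (\int[P]_t lo t <= \int[P]_t Lr t)%R.
  by apply: ae_le_Rintegral => //; apply: filterS bounds => t /andP[].
rewrite RintegralD// RintegralB// RintegralB// RintegralD//.
rewrite Rintegral_cst// (_ : fine _ = 1%R) ?mulr1; last first.
  by rewrite [X in fine X](_ : _ = 1)//; exact: probability_setT.
move=> main.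
have : (\int[P]_t R2 t <= 1)%R by rewrite -lee_fin -finE.
rewrite -!EFinN -!EFinD lee_fin; lra.
Qed.

End submodularity.

(** * Independence of three variables and of their partial groupings *)

Lemma independent2C {R : realType} {d d1 d2 : measure_display}
    {T : measurableType d} {T1 : measurableType d1} {T2 : measurableType d2}
    (P : probability T R) (V : T -> T1) (U : T -> T2) :
  independent2 P V U -> independent2 P U V.
Proof. by move=> VU D E mD mE; rewrite setIC VU// muleC. Qed.

Section triple_independence.
Local Open Scope ereal_scope.
Context {R : realType} {d : measure_display} {T : measurableType d}.
Variable P : probability T R.

Definition independent3 (A B C : T -> R) :=
  forall D E F, measurable D -> measurable E -> measurable F ->
    P (A @^-1` D `&` B @^-1` E `&` C @^-1` F) =
    P (A @^-1` D) * P (B @^-1` E) * P (C @^-1` F).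

Lemma independent3_rot A B C : independent3 A B C -> independent3 B C A.
Proof.
move=> ABC D E F mD mE mF.
by rewrite setIC setIA ABC// -muleA [LHS]muleC.
Qed.

Lemma independent3_swap A B C : independent3 A B C -> independent3 B A C.
Proof.
move=> ABC D E F mD mE mF.
by rewrite (setIC (_ @^-1` D)) ABC// (muleC (P (B @^-1` D))).
Qed.

Lemma independent3_2 A B C : independent3 A B C -> independent2 P A B.
Proof.
move=> ABC D E mD mE; have := ABC D E setT mD mE measurableT.
by rewrite preimage_setT setIT => ->; rewrite [P setT]probability_setT mule1.
Qed.

Lemma independent3_pair A B C :
  measurable_fun setT A -> measurable_fun setT B -> measurable_fun setT C ->
  independent3 A B C -> independent2 P (fun t => (A t, B t)) C.
Proof.
move=> mA mB mC ABC D F mD mF; apply: independent_pair_event => //.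
  exact: measurable_preimageT.
by move=> X Y mX mY; rewrite ABC// (independent3_2 ABC).
Qed.

Lemma independent3_add A B C :
  measurable_fun setT A -> measurable_fun setT B -> measurable_fun setT C ->
  independent3 A B C -> independent2 P (fun t => A t + B t)%R C.
Proof.
move=> mA mB mC ABC D F mD mF.
have mD' : measurable_fun setT (fun x : R * R => x.1 + x.2)%R.
  exact: measurable_funD.
exact: (independent3_pair mA mB mC ABC (measurable_preimageT mD' mD) mF).
Qed.

End triple_independence.

(** * The law of an independent sum in terms of the two densities *)

Section law_add.
Local Open Scope ereal_scope.
Context {R : realType} {d : measure_display} {T : measurableType d}.
Variable P : probability T R.
Notation mu := (@lebesgue_measure R).

(** The right-hand side mentions only [f] and [g], so independent sums with the same marginal
    densities have the same law. *)
Lemma probability_add_density (V U : T -> R) (f g : R -> R) (B : set R) :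
  measurable_fun setT V -> measurable_fun setT U -> independent2 P V U ->
  has_density P V f -> has_density P U g -> measurable B ->
  P ((fun t => V t + U t)%R @^-1` B) =
  \int[mu]_y ((g y)%:E * \int[mu]_x ((f x)%:E * (\1_B (x + y)%R)%:E)).
Proof.
move=> mV mU VU df dg mB.
have [mf f0 _] := df.
have mVU : measurable_fun setT (fun t => V t + U t)%R by exact: measurable_funD.
rewrite -[X in P X]setIT -integral_indic//; last exact: measurable_preimageT.
rewrite (_ : \int[P]_t _ =
    \int[P]_t (\1_B ((V t, U t).1 + (V t, U t).2)%R)%:E)//.
have mB' : measurable_fun setT (fun y : R * R => (\1_B (y.1 + y.2)%R : R)).
  by apply: (measurableT_comp (measurable_indic mB)); exact: measurable_funD.
rewrite (ge0_expectation_independent_density mV mU VU df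
  (F := fun y => (\1_B (y.1 + y.2)%R)%:E)); last 2 first.
- exact/measurable_EFinP.
- by move=> x; rewrite lee_fin.
rewrite (ge0_expectation_density mU dg
  (g := fun y => \int[mu]_x ((f x)%:E * (\1_B (x + y)%R)%:E)))//.
- apply: (measurable_fun_fubini_tonelli_G (m1 := mu)
    (fun y : measurableTypeR R * R => (f y.1)%:E * (\1_B (y.1 + y.2)%R)%:E)).
    apply: emeasurable_funM; apply/measurable_EFinP => //.
    by apply: measurableT_comp.
  by move=> y; rewrite mule_ge0// lee_fin.
- by move=> y; apply: integral_ge0 => x _; rewrite mule_ge0// lee_fin.
Qed.

End law_add.

(** * Partial sums and their independence from later terms *)

Section partial_sums.
Local Open Scope ereal_scope.
Context {R : realType} {d : measure_display} {T : measurableType d}.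
Variables (P : probability T R) (m : nat) (Z : nat -> T -> R).
Hypothesis mZ : forall i, measurable_fun setT (Z i).
Hypothesis indZ : mutually_independent P (fun i : 'I_m => Z i).

(** The index is that of the last term, so there are [k.+1] summands. The recursion exposes the last
    summand by computation, as submodularity requires. *)
Fixpoint partial_sum k : T -> R :=
  if k is k'.+1 then fun t => (partial_sum k' t + Z k'.+1 t)%R else Z 0%N.

Lemma partial_sumE k t : partial_sum k t = (\sum_(i < k.+1) Z i t)%R.
Proof. by elim: k => [|k IH] /=; rewrite big_ord_recr/= ?big_ord0 ?add0r ?IH. Qed.

Lemma measurable_partial_sum k : measurable_fun setT (partial_sum k).
Proof. by elim: k => [|k IH]; [exact: mZ|exact: measurable_funD]. Qed.

Let event k (B : nat -> set R) := \big[setI/setT]_(k <= i < m) (Z i @^-1` B i).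
Let prob k (B : nat -> set R) := \prod_(k <= i < m) P (Z i @^-1` B i).

Let measurable_event k B : (forall i, measurable (B i)) -> measurable (event k B).
Proof.
move=> mB; rewrite /event; elim/big_ind: _ => // [|i _].
  exact: measurableI.
exact: measurable_preimageT.
Qed.

Let event_setT k : event k (fun=> setT) = setT.
Proof. by rewrite /event big1. Qed.

Let prob_setT k : prob k (fun=> setT) = 1.
Proof. by rewrite /prob big1// => i _; exact: probability_setT. Qed.

(** Induction on [k] with the later events kept general. The induction hypothesis, with its first
    later event split off, factors over the old sum, the new term and the rest; passing from
    rectangles to pairs then reaches the new sum. *)
Let independent_partial_sum_event k : (k < m)%N -> forall B C,
  (forall i, measurable (B i)) -> measurable C ->
  P (partial_sum k @^-1` C `&` event k.+1 B) =
  P (partial_sum k @^-1` C) * prob k.+1 B.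
Proof.
elim: k => [|k IH] km B C mB mC.
  (* The family constrains the first variable, which is the whole partial sum here, by [C]. *)
  pose B' i := if i == 0%N then C else B i.
  have mB' i : measurable (B' i) by rewrite /B'; case: ifP.
  have := @indZ (fun i => B' i) (fun i => mB' i).
  rewrite -(big_mkord xpredT (fun i => P (Z i @^-1` B' i))).
  rewrite (_ : \bigcap_(i in _) _ = event 0 B'); last first.
    rewrite /event big_mkord -(bigcap_mkord m (fun i => Z i @^-1` B' i)); apply/seteqP; split=> t Ht i im.
      exact: (Ht (Ordinal im)).
    exact: (Ht i (ltn_ord i)).
  rewrite /event /prob !(big_ltn km)/= {1 3}/B' eqxx => E.
  rewrite [X in _ `&` X](_ : _ = \big[setI/setT]_(1 <= i < m) (Z i @^-1` B' i)); last first.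
    by apply: eq_big_nat => i /andP[i1 _]; rewrite /B' gtn_eqF.
  rewrite E; congr (_ * _).
  by apply: eq_big_nat => i /andP[i1 _]; rewrite /B' gtn_eqF.
have {}IH := IH (ltnW km).
have split D B0 : (forall i, measurable (B0 i)) -> measurable D ->
    forall E, measurable E ->
    P (partial_sum k @^-1` E `&` Z k.+1 @^-1` D `&` event k.+2 B0) =
    P (partial_sum k @^-1` E) * P (Z k.+1 @^-1` D) * prob k.+2 B0.
  move=> mB0 mD E mE.
  pose B' i := if i == k.+1 then D else B0 i.
  have mB' i : measurable (B' i) by rewrite /B'; case: ifP.
  have := IH B' E mB' mE.
  rewrite /event /prob !(big_ltn km)/= {1 3}/B' eqxx setIA muleA.
  rewrite (eq_big_nat _ _ (F2 := fun i => Z i @^-1` B0 i)); last first.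
    by move=> i /andP[i1 _]; rewrite /B' gtn_eqF.
  move=> ->; congr (_ * _); apply: eq_big_nat => i /andP[i1 _].
  by rewrite /B' gtn_eqF.
have split2 D E : measurable D -> measurable E ->
    P (partial_sum k @^-1` E `&` Z k.+1 @^-1` D) =
    P (partial_sum k @^-1` E) * P (Z k.+1 @^-1` D).
  move=> mD mE; have := split D (fun=> setT) (fun=> measurableT) mD E mE.
  by rewrite event_setT prob_setT setIT mule1.
have eventE : P (event k.+2 B) = prob k.+2 B.
  have := split setT B mB measurableT setT measurableT.
  by rewrite !preimage_setT !setTI [P setT]probability_setT !mul1e.
have mA := measurable_partial_sum k.
have mD' : measurable_fun setT (fun x : R * R => x.1 + x.2)%R.
  exact: measurable_funD.
(* The event for the new sum is the preimage, under the pair (old sum, new term), of the set of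
   points whose coordinate sum lies in [C]. *)
rewrite -eventE; apply: (independent_pair_event mA (mZ k.+1) (measurable_event _ mB) _
  (D := [set x | C (x.1 + x.2)%R])).
  by move=> E D mE mD; rewrite split// eventE split2.
exact: (measurable_preimageT mD').
Qed.

Lemma independent3_partial_sum k : (k.+2 < m)%N ->
  independent3 P (partial_sum k) (Z k.+1) (Z k.+2).
Proof.
move=> km D E F mD mE mF.
(* Variables after [k.+2] are unconstrained, so the tails of the intersection and of the product are
   trivial. *)
pose B i := if i == k.+1 then E else if i == k.+2 then F else setT.
have mB i : measurable (B i) by rewrite /B; case: ifP => // _; case: ifP.
have := independent_partial_sum_event (ltnW (ltnW km)) mB mD.
rewrite /event /prob !(big_ltn (ltnW km)) !(big_ltn km).
have -> : B k.+1 = E by rewrite /B eqxx.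
have -> : B k.+2 = F by rewrite /B (gtn_eqF (ltnSn _)) eqxx.
rewrite big_nat_cond [X in _ * (_ * (_ * X))]big_nat_cond big1 1?big1; last 2 first.
- move=> i /andP[/andP[i1 _] _]; rewrite /B !gtn_eqF ?(ltnW i1)//.
  exact: probability_setT.
- by move=> i /andP[/andP[i1 _] _]; rewrite /B !gtn_eqF ?(ltnW i1)//.
by rewrite setIT mule1 setIA muleA.
Qed.

Lemma independent2_first : (1 < m)%N -> independent2 P (Z 0%N) (Z 1%N).
Proof.
move=> m1 D E mD mE.
pose B i := if i == 1%N then E else setT.
have mB i : measurable (B i) by rewrite /B; case: ifP.
have := independent_partial_sum_event (ltnW m1) mB mD.
rewrite /event /prob !(big_ltn m1).
have -> : B 1%N = E by rewrite /B eqxx.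
rewrite big_nat_cond [X in _ * (_ * X)]big_nat_cond big1 1?big1; last 2 first.
- move=> i /andP[/andP[i1 _] _]; rewrite /B !gtn_eqF//.
  exact: probability_setT.
- by move=> i /andP[/andP[i1 _] _]; rewrite /B !gtn_eqF.
by rewrite setIT mule1.
Qed.

End partial_sums.

(** * Induction on the entropy of partial sums *)

Section entropy_partial_sum.
Context {R : realType} {d : measure_display} {T : measurableType d}.
Variables (P : probability T R) (m : nat) (Z : nat -> T -> R).
Variables (f : nat -> R -> R) (g : R -> R).
Hypothesis mZ : forall i, measurable_fun setT (Z i).
Hypothesis indZ : mutually_independent P (fun i : 'I_m => Z i).
Hypothesis df : forall i, has_density P (Z i) (f i).
Hypothesis finf : forall i, entropy_finite (f i).
Hypothesis dg : forall i, (i.+1 < m)%N ->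
  has_density P (fun t => Z i.+1 t + Z i t) g.
Hypothesis fing : entropy_finite g.

Let h (u : R -> R) : R := fine (diff_entropy u).

Lemma diff_entropy_fin (u : R -> R) : entropy_finite u ->
  diff_entropy u = (fine (diff_entropy u))%:E.
Proof. by move=> iu; rewrite fineK// fin_numN; exact: integrable_fin_num. Qed.

(** Submodularity is used with [A := partial_sum Z k], [Z := Z k.+1], [W := Z k.+2]. The sum of the
    first two variables has density [g] and starts the induction without loss, so the subtracted
    entropies begin at index 1. *)
Lemma entropy_partial_sum k : (k.+1 < m)%N ->
  exists r, [/\ has_density P (partial_sum Z k.+1) r, entropy_finite r &
    h r <= k.+1%:R * h g - \sum_(i < k) h (f i.+1)].
Proof.
elim: k => [|k IH] km.
  exists g; split => //; last by rewrite big_ord0 mul1r subr0.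
  have -> : partial_sum Z 1 = fun t => Z 1%N t + Z 0%N t; last exact: dg.
  by apply/funext => t /=; rewrite addrC.
have [p [dp finp lep]] := IH (ltnW km).
have mA := measurable_partial_sum mZ k.
have i3 := independent3_partial_sum mZ indZ km.
have i3' := independent3_rot (independent3_swap i3).
have AZ_W := independent3_add mA (mZ _) (mZ _) i3.
have WZ_A := independent3_add (mZ _) (mZ _) mA (independent3_swap (independent3_rot i3)).
have Z_AW := independent2C (independent3_pair mA (mZ _) (mZ _) i3').
have AW := independent3_2 i3'.
have [r dr] := has_density_add (measurable_partial_sum mZ k.+1) (mZ k.+2) AZ_W dp.
have [finr ler] := entropy_submodular mA (mZ k.+2) (mZ k.+1) Z_AW AW AZ_W WZ_A
  (df k.+1) dp (dg km) dr (finf _) finp fing.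
exists r; split => //.
move: ler; rewrite (diff_entropy_fin finr) (diff_entropy_fin finp)
  (diff_entropy_fin fing) (diff_entropy_fin (finf k.+1)).
rewrite -!EFinD lee_fin -!/(h _) => ler.
rewrite big_ord_recr/= -[k.+2%:R]natr1.
lra.
Qed.

End entropy_partial_sum.

(** * Transfer lemmas, interleaving of the two families, and conclusion *)

Lemma diff_entropy_unique {R : realType} {d : measure_display}
    {T : measurableType d} (P : probability T R) (V : T -> R) (f g : R -> R) :
  has_density P V f -> has_density P V g -> diff_entropy f = diff_entropy g.
Proof.
move=> df dg; have [mf _ _] := df; have [mg _ _] := dg.
have mln (u : R -> R) : measurable_fun setT u ->
    measurable_fun setT (fun x => (u x * ln (u x))%:E).
  move=> mu; apply/measurable_EFinP/measurable_funM => //.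
  by apply: measurableT_comp => //; exact: measurable_ln.
rewrite /diff_entropy; congr oppe; apply: ae_eq_integral => //; [exact: mln..|].
by apply: filterS (density_unique df dg) => x /(_ I) [fg] _; rewrite fg.
Qed.

(** Serves to pass from the two families indexed by a disjoint sum to one interleaved sequence;
    events are pulled back along the inverse bijection. *)
Lemma mutually_independent_reindex {R : realType} {d : measure_display}
    {T : measurableType d} (P : probability T R) (K J : finType)
    (Z : K -> T -> R) (s : J -> K) : bijective s ->
  mutually_independent P Z -> mutually_independent P (Z \o s).
Proof.
move=> [s' sK s'K] indZ B mB.
have := indZ (B \o s') (fun i => mB (s' i)).
rewrite (reindex s) /=; last by exists s' => j _; [exact: sK|exact: s'K].
under eq_bigr do rewrite sK.
move=> <-; congr (P _); apply/seteqP; split => t Ht i _ /=.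
  by have := Ht (s' i) I => /=; rewrite s'K.
by have := Ht (s i) I => /=; rewrite sK.
Qed.

Lemma has_density_same_distribution {R : realType} {d : measure_display}
    {T : measurableType d} (P : probability T R) (V U : T -> R) (f : R -> R) :
  same_distribution P V U -> has_density P U f -> has_density P V f.
Proof. by move=> VU [mf f0 fE]; split => // B mB; rewrite VU// fE. Qed.

Unset Implicit Arguments.

Theorem mainTheorem12 (R : realType) (d : measure_display) (T : measurableType d)
  (P : probability T R) (n : nat) (X Y : 'I_n.+1 -> {RV P >-> R})
  (fX fY fXY fS : R -> R) :
  mutually_independent P
    (fun k : 'I_n.+1 + 'I_n.+1 => match k with inl i => X i | inr i => Y i end) ->
  (forall i, same_distribution P (X i) (X ord0)) ->
  (forall i, same_distribution P (Y i) (Y ord0)) ->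
  has_density P (X ord0) fX -> entropy_finite fX ->
  has_density P (Y ord0) fY -> entropy_finite fY ->
  has_density P (fun t => X ord0 t + Y ord0 t) fXY -> entropy_finite fXY ->
  has_density P (fun t => \sum_(i < n.+1) (X i t + Y i t)) fS -> entropy_finite fS ->
  (diff_entropy fS <=
     (2 * n + 1)%:R%:E * diff_entropy fXY - n%:R%:E * diff_entropy fX
       - n%:R%:E * diff_entropy fY)%E.
Proof.
move=> ind sX sY dX finX dY finY dXY finXY dS finS.
pose m := n.+1.*2.
(* Position 2i holds X_i and position 2i + 1 holds Y_i. Beyond the range of [m], [inord] falls back
   to index 0, so [Z j] still has density [f j] for every natural [j]. *)
pose s (j : 'I_m) : 'I_n.+1 + 'I_n.+1 :=
  if odd j then inr (inord j./2) else inl (inord j./2).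
pose Z (j : nat) : T -> R := if odd j then Y (inord j./2) else X (inord j./2).
pose f (j : nat) : R -> R := if odd j then fY else fX.
have mX i : measurable_fun setT (X i) by exact: measurable_funPT.
have mY i : measurable_fun setT (Y i) by exact: measurable_funPT.
have mZ j : measurable_fun setT (Z j) by rewrite /Z; case: ifP.
have df j : has_density P (Z j) (f j).
  by rewrite /Z /f; case: ifP => _; apply: has_density_same_distribution;
    [exact: sY|exact: dY|exact: sX|exact: dX].
have finf j : entropy_finite (f j) by rewrite /f; case: ifP.
have halfm (j : 'I_m) : (j./2 < n.+1)%N by rewrite ltn_half_double.
(* Parity and half determine [j], and both index types have 2(n + 1) elements. *)
have bij_s : bijective s.
  apply: inj_card_bij; last by rewrite card_sum !card_ord addnn.
  move=> i j; rewrite /s.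
  case: ifP => oi; case: ifP => oj // [] /(congr1 val); rewrite /= !inordK// => ij;
    apply: val_inj; by rewrite /= -(odd_double_half i) -(odd_double_half j) oi oj ij.
have indZ : mutually_independent P (fun j : 'I_m => Z j).
  have := mutually_independent_reindex bij_s ind.
  congr (mutually_independent P _); apply/funext => j /=.
  by rewrite /s /Z; case: ifP.
have ind2 j : (j.+1 < m)%N -> independent2 P (Z j) (Z j.+1).
  case: j => [|j] jm; first exact: independent2_first indZ _.
  exact: independent3_2 (independent3_rot (independent3_partial_sum mZ indZ jm)).
have XY0 : independent2 P (X ord0) (Y ord0).
  have := @ind2 0%N isT; rewrite /Z /=.
  by rewrite (_ : inord 0 = ord0)//; apply: val_inj; rewrite /= inordK.
(* Neighbours are always one X and one Y, possibly with different indices; their sum has the law of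
   X_0 + Y_0 because that law depends only on [fX] and [fY]. Even [j] needs a commutation. *)
have dg j : (j.+1 < m)%N -> has_density P (fun t => Z j.+1 t + Z j t) fXY.
  move=> jm; apply: has_density_same_distribution dXY => B mB.
  rewrite (probability_add_density (mX ord0) (mY ord0) XY0 dX dY mB).
  have := df j; have := df j.+1; have := ind2 j jm; rewrite /f /=.
  case: (odd j) => ij /= d1 d2.
    exact: (probability_add_density (mZ _) (mZ _) (independent2C ij) d1 d2 mB).
  under eq_fun do rewrite addrC.
  exact: (probability_add_density (mZ _) (mZ _) ij d2 d1 mB).
(* Index 2n + 1 is the last of the 2n + 2 variables, reached after 2n submodularity steps. *)
have km : (n.*2.+1 < m)%N by rewrite /m doubleS.
have [r [dr finr ler]] := entropy_partial_sum mZ indZ df finf dg finXY km.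
have sumE : partial_sum Z n.*2.+1 = fun t => \sum_(i < n.+1) (X i t + Y i t).
  apply/funext => t; rewrite partial_sumE.
  have sum2 k : \sum_(i < k.*2) Z i t =
      \sum_(i < k) (X (inord i) t + Y (inord i) t).
    elim: k => [|k IH]; first by rewrite !big_ord0.
    rewrite doubleS !big_ord_recr/= IH /Z /= odd_double/= doubleK.
    by rewrite -addrA uphalf_double.
  rewrite -doubleS sum2; apply: eq_bigr => i _.
  by rewrite inord_val.
(* For [k = n] these are the entropies of Z_1, ..., Z_(2n): n copies each of h(Y) and h(X), the two
   end variables being left out. *)
have sumf k : \sum_(i < k.*2) fine (diff_entropy (f i.+1)) =
    k%:R * (fine (diff_entropy fX) + fine (diff_entropy fY)).
  elim: k => [|k IH]; first by rewrite big_ord0 mul0r.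
  rewrite doubleS !big_ord_recr/= IH /f /= odd_double/=.
  rewrite -[k.+1%:R]natr1; lra.
rewrite sumE in dr.
(* The given [fS] and the density [r] from the induction belong to the same sum, so their entropies
   coincide. *)
rewrite (diff_entropy_unique dS dr) (diff_entropy_fin finr)
  (diff_entropy_fin finXY) (diff_entropy_fin finX) (diff_entropy_fin finY).
rewrite -!EFinM -!EFinB lee_fin; move: ler; rewrite sumf.
rewrite -addn1 -muln2 mulnC; lra.
Qed.
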